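(* Let $\varepsilon>0$, $r\ge0$, and suppose that the CFL condition $v_{\max}\,\Delta t/\Delta x<1$ holds. Let $m>0$, and let $(\phi^n_i)$, $(\eta^n_{i,j})$ be given by the scheme $(S_\varepsilon)$ defined in the context. Assume that $0\le\phi^0_i\le m$ and $\eta^0_{i,j}=0$ for all $i\in\{1,\dots,N_x\}$ and $j\in\{1,\dots,N_v\}$. Then for all $n\in\{0,\dots,N_t-1\}$ and all $(i,j)\in\{1,\dots,N_x\}\times\{1,\dots,N_v\}$ the following properties hold: 1. $0\le\phi^{n+1}_i\le m$; 2. $0\le\eta^{n+1}_{i,j}+\phi^{n+1}_i\le m$; 3. $\displaystyle 0\le\phi^{n+1}_i+\eta^{n+1}_{i,j}-\Delta t\left(1-e^{\eta^{n+1}_{i,j}/\varepsilon}\right)+r\Delta t\,e^{\eta^{n+1}_{i,j}/\varepsilon}\left(1-e^{-\left(\phi^{n+1}_i+\eta^{n+1}_{i,j}\right)/\varepsilon}\right)\le m.$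
   Context: **Grids.** Space: $x_i=-x_{\max}+\frac{\Delta x}{2}+(i-1)\Delta x$, $i=1,\dots,N_x=2N_x'$, with $\Delta x=x_{\max}/N_x'$. Velocity: $v_j=-v_{\max}+\frac{\Delta v}{2}+(j-1)\Delta v$, $j=1,\dots,N_v=2N_v'$, with $\Delta v=v_{\max}/N_v'$. Time: $t_n=n\Delta t$, $n=0,\dots,N_t$, with $\Delta t=T/N_t$. The values at the spatial indices $0$ and $N_x+1$ are given either by periodic boundary conditions (value at index $0$ equals value at $N_x$, value at $N_x+1$ equals value at $1$) or by homogeneous Neumann boundary conditions (value at index $0$ equals value at $1$, value at $N_x+1$ equals value at $N_x$). The discrete velocity integral is $\langle g\rangle_{N_v}=\Delta v\sum_{j=1}^{N_v}g_j$, where $g_j$ is the value of $g$ at $v_j$ (if $g$ depends on the index $j$, the sum is over that index). Set $v_j^+=\max(v_j,0)$ and $v_j^-=\min(v_j,0)$. **Equilibrium.** $M:[-v_{\max},v_{\max}]\to\mathbb{R}$ is even and continuous, $\inf M>0$, normalized so that $\langle M\rangle_{N_v}=1$. **Scheme $(S_\varepsilon)$.** Given $\phi^0_i$ and $\eta^0_{i,j}$, for $n\in\{0,\dots,N_t-1\}$ the numbers $\phi^{n+1}_i$, $H^{n+1}_i$, $\eta^{n+1}_{i,j}$ solve $$\frac{\phi^{n+1}_i-\phi^n_i}{\Delta t}+H^{n+1}_i+r=0,$$ $$1+H^{n+1}_i+r-\frac{\eta^{n+1}_{i,j}-\eta^n_{i,j}}{\Delta t}-[v\partial_x(\phi+\eta)]^n_{i,j}+r\,e^{(r\Delta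 t-\phi^n_i)/\varepsilon}\,e^{\Delta t\,H^{n+1}_i/\varepsilon}=(1+r)\,e^{\eta^{n+1}_{i,j}/\varepsilon},$$ $$\langle M e^{-\eta^{n+1}_{i,j}/\varepsilon}\rangle_{N_v}=1,$$ for all $i\in\{1,\dots,N_x\}$, $j\in\{1,\dots,N_v\}$, with the upwind transport term $$[v\partial_x(\phi+\eta)]^n_{i,j}=v_j^+\,\frac{(\phi^n_i+\eta^n_{i,j})-(\phi^n_{i-1}+\eta^n_{i-1,j})}{\Delta x}+v_j^-\,\frac{(\phi^n_{i+1}+\eta^n_{i+1,j})-(\phi^n_i+\eta^n_{i,j})}{\Delta x}.$$ *)

(* Defs.v *)
From HB Require Import structures.
From mathcomp Require Import all_boot all_order all_algebra.
From mathcomp Require Import all_classical all_reals all_analysis.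

Set Implicit Arguments.
Unset Strict Implicit.
Unset Printing Implicit Defensive.

Import Order.TTheory GRing.Theory Num.Theory.
Import numFieldNormedType.Exports.

Local Open Scope classical_set_scope.
Local Open Scope ring_scope.

(* [half_Nx] and [half_Nv] are the integers N_x' and N_v', i.e. half of the
   (even) numbers of cells in space and velocity. *)
Record grid (R : realType) := Grid {
  xmax : R;
  vmax : R;
  Tmax : R;
  half_Nx : nat;
  half_Nv : nat;
  Nt : nat;
  xmax_gt0 : 0 < xmax;
  vmax_gt0 : 0 < vmax;
  Tmax_gt0 : 0 < Tmax;
  half_Nx_gt0 : (0 < half_Nx)%N;
  half_Nv_gt0 : (0 < half_Nv)%N;
  Nt_gt0 : (0 < Nt)%N
}.

(* Space and velocity indices are 1-based natural numbers, time indices are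
   0-based: a grid function is a function on nat of which only the values at
   i in {1..Nx}, j in {1..Nv}, n in {0..Nt} are ever used. *)
Section Discretization.
Variables (R : realType) (g : grid R).

Definition Nx : nat := (2 * half_Nx g)%N.
Definition Nv : nat := (2 * half_Nv g)%N.

Definition dx : R := xmax g / (half_Nx g)%:R.
Definition dv : R := vmax g / (half_Nv g)%:R.
Definition dt : R := Tmax g / (Nt g)%:R.

Definition vnode (j : nat) : R := - vmax g + dv / 2 + (j%:R - 1) * dv.
Definition vplus (j : nat) : R := Num.max (vnode j) 0.
Definition vminus (j : nat) : R := Num.min (vnode j) 0.

Definition vsum (f : nat -> R) : R := dv * \sum_(1 <= j < Nv.+1) f j.

Record equilibrium (M : R -> R) : Prop := Equilibrium {
  equilibrium_even : forall v, v \in `[- vmax g, vmax g] -> M (- v) = M v;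
  equilibrium_cont : {within `[- vmax g, vmax g], continuous M};
  equilibrium_inf : 0 < inf (M @` `[- vmax g, vmax g]);
  equilibrium_norm : vsum (fun j => M (vnode j)) = 1
}.

End Discretization.

Inductive boundary_condition := Periodic | Neumann.

Section Scheme.
Variables (R : realType) (g : grid R) (bc : boundary_condition).

(* The values at the ghost indices 0 and Nx + 1 are overridden by those that
   the boundary condition prescribes. *)
Definition extend (f : nat -> R) (i : nat) : R :=
  if i == 0%N then
    match bc with Periodic => f (Nx g) | Neumann => f 1%N end
  else if i == (Nx g).+1 then
    match bc with Periodic => f 1%N | Neumann => f (Nx g) end
  else f i.

Definition upwind (phi : nat -> R) (eta : nat -> nat -> R) (i j : nat) : R :=
  let u k := extend phi k + extend (fun l => eta l j) k in
  vplus g j * ((u i - u i.-1) / dx g) + vminus g j * ((u i.+1 - u i) / dx g).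

(* [phi n i], [H n i] and [eta n i j] are indexed by time, space, velocity;
   [H 0] plays no role. *)
Record scheme (eps r : R) (M : R -> R)
    (phi H : nat -> nat -> R) (eta : nat -> nat -> nat -> R) : Prop := Scheme {
  scheme_phi : forall n i, (n < Nt g)%N -> (1 <= i <= Nx g)%N ->
    (phi n.+1 i - phi n i) / dt g + H n.+1 i + r = 0;
  scheme_eta : forall n i j, (n < Nt g)%N -> (1 <= i <= Nx g)%N ->
      (1 <= j <= Nv g)%N ->
    1 + H n.+1 i + r - (eta n.+1 i j - eta n i j) / dt g
      - upwind (phi n) (eta n) i j
      + r * expR ((r * dt g - phi n i) / eps) * expR (dt g * H n.+1 i / eps)
    = (1 + r) * expR (eta n.+1 i j / eps);
  scheme_norm : forall n i, (n < Nt g)%N -> (1 <= i <= Nx g)%N ->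
    vsum g (fun j => M (vnode g j) * expR (- eta n.+1 i j / eps)) = 1
}.

End Scheme.

(* Main.v *)
Require Import Defs.
From HB Require Import structures.
From mathcomp Require Import all_boot all_order all_algebra.
From mathcomp Require Import all_classical all_reals all_analysis.
From mathcomp Require Import ring lra.

Set Implicit Arguments.
Unset Strict Implicit.

Import Order.TTheory GRing.Theory Num.Theory.
Import numFieldNormedType.Exports.

Local Open Scope classical_set_scope.
Local Open Scope ring_scope.

(** The argument is a discrete maximum principle for [u = phi + eta].

    Eliminating [H] between the first two equations of the scheme turns the
    kinetic equation into [transported = G phi' eta'] ([scheme_step]), where
    the primes denote the new time level, [transported] is [u] after one
    explicit upwind step, and
    [G p e = p + e - dt (1 - exp (e / eps))
             + r dt exp (e / eps) (1 - exp (- (p + e) / eps))].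
    Under the CFL condition an upwind step is a convex combination of
    neighbouring values of [u], so if [u] lies in [[0, m]] at time [n], then
    so does [G phi' eta'] ([transport_bounds]); this is the third property.

    The normalizations [<M> = 1] and [<M exp (- eta' / eps)> = 1], with [M]
    positive, force [eta'] to be [>= 0] at one velocity and [<= 0] at another
    ([equal_sums_le]).  At the former [G phi' eta' <= m] gives [phi' <= m], at
    the latter [G phi' eta' >= 0] gives [phi' >= 0].  Finally,
    [phi' + eta' > m] would need [eta' > 0] because [phi' <= m], and then both
    nonlinear terms of [G] are nonnegative, so [G phi' eta' > m]; values below
    [0] are excluded in the same way ([implicit_bounds]).  This closes the
    induction on [n]. *)

(** * The implicit relaxation step *)

Section ImplicitStep.
Variables (R : realType) (eps r tau m : R).
Hypotheses (eps_gt0 : 0 < eps) (r_ge0 : 0 <= r) (tau_gt0 : 0 < tau).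
Hypothesis m_gt0 : 0 < m.

(** The part of the scheme that is implicit in the new values [p] of [phi] and
    [e] of [eta]; [tau] is the time step. *)
Definition implicit_part (p e : R) : R :=
  p + e - tau * (1 - expR (e / eps))
  + r * tau * expR (e / eps) * (1 - expR (- (p + e) / eps)).

Lemma expR_div_le1 (x : R) : (expR (x / eps) <= 1) = (x <= 0).
Proof. by rewrite -expR0 ler_expR ler_pdivrMr // mul0r. Qed.

Lemma expR_div_ge1 (x : R) : (1 <= expR (x / eps)) = (0 <= x).
Proof. by rewrite -expR0 ler_expR ler_pdivlMr // mul0r. Qed.

(** If [p > m] while [e >= 0], the relaxation term is nonnegative because of
    the sign of [e] and the growth term because [p + e > 0], so
    [implicit_part p e >= p > m]. *)
Lemma implicit_part_le_phi (p e : R) :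
  0 <= e -> implicit_part p e <= m -> p <= m.
Proof.
move=> e_ge0 Gm; have m0 := m_gt0; rewrite leNgt; apply/negP => m_lt_p.
have : 0 <= tau * (expR (e / eps) - 1).
  by rewrite mulr_ge0 ?(ltW tau_gt0)// subr_ge0 expR_div_ge1.
have : 0 <= r * tau * expR (e / eps) * (1 - expR (- (p + e) / eps)).
  rewrite !mulr_ge0 ?(ltW tau_gt0) ?expR_ge0// subr_ge0 expR_div_le1; lra.
by move: Gm; rewrite /implicit_part; lra.
Qed.

Lemma implicit_part_ge_phi (p e : R) :
  e <= 0 -> 0 <= implicit_part p e -> 0 <= p.
Proof.
move=> e_le0 G0; rewrite leNgt; apply/negP => p_lt0.
have : 0 <= tau * (1 - expR (e / eps)).
  by rewrite mulr_ge0 ?(ltW tau_gt0)// subr_ge0 expR_div_le1.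
have : 0 <= r * tau * expR (e / eps) * (expR (- (p + e) / eps) - 1).
  rewrite !mulr_ge0 ?(ltW tau_gt0) ?expR_ge0// subr_ge0 expR_div_ge1; lra.
by move: G0; rewrite /implicit_part; lra.
Qed.

(** An overshoot [p + e > m] with [p <= m] needs [e > 0], and then both
    the relaxation and the growth term are nonnegative, so
    [implicit_part p e > m]; an undershoot is excluded in the same way. *)
Lemma implicit_bounds (p e : R) :
  0 <= p <= m -> 0 <= implicit_part p e <= m -> 0 <= e + p <= m.
Proof.
move=> /andP[p_ge0 p_lem] /andP[G0 Gm]; have m0 := m_gt0; apply/andP; split.
- rewrite leNgt; apply/negP => s_lt0.
  have : 0 <= tau * (1 - expR (e / eps)).
    rewrite mulr_ge0 ?(ltW tau_gt0)// subr_ge0 expR_div_le1; lra.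
  have : 0 <= r * tau * expR (e / eps) * (expR (- (p + e) / eps) - 1).
    rewrite !mulr_ge0 ?(ltW tau_gt0) ?expR_ge0// subr_ge0 expR_div_ge1; lra.
  by move: G0; rewrite /implicit_part; lra.
- rewrite leNgt; apply/negP => m_lt_s.
  have : 0 <= tau * (expR (e / eps) - 1).
    rewrite mulr_ge0 ?(ltW tau_gt0)// subr_ge0 expR_div_ge1; lra.
  have : 0 <= r * tau * expR (e / eps) * (1 - expR (- (p + e) / eps)).
    rewrite !mulr_ge0 ?(ltW tau_gt0) ?expR_ge0// subr_ge0 expR_div_le1; lra.
  by move: Gm; rewrite /implicit_part; lra.
Qed.

End ImplicitStep.

(** * Grid and equilibrium *)

Section GridFacts.
Variables (R : realType) (g : grid R).

Lemma dt_gt0 : 0 < dt g.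
Proof. by rewrite divr_gt0 ?ltr0n ?Nt_gt0 ?Tmax_gt0. Qed.

Lemma dx_gt0 : 0 < dx g.
Proof. by rewrite divr_gt0 ?ltr0n ?half_Nx_gt0 ?xmax_gt0. Qed.

Lemma dv_gt0 : 0 < dv g.
Proof. by rewrite divr_gt0 ?ltr0n ?half_Nv_gt0 ?vmax_gt0. Qed.

Lemma vnode_bounds (j : nat) :
  (1 <= j <= Nv g)%N -> - vmax g <= vnode g j <= vmax g.
Proof.
move=> /andP[j1 jN]; have dv0 := dv_gt0.
have vmaxE : vmax g = (half_Nv g)%:R * dv g.
  by rewrite /dv mulrCA divff ?mulr1// pnatr_eq0 -lt0n half_Nv_gt0.
have lo : 0 <= (j%:R - 1) * dv g by rewrite mulr_ge0 ?(ltW dv0)// subr_ge0 ler1n.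
have hi : j%:R * dv g <= 2 * ((half_Nv g)%:R * dv g).
  by rewrite mulrA ler_pM2r// -natrM ler_nat.
by rewrite /vnode; apply/andP; split; lra.
Qed.

(** By convention [inf] is [0] on a set without a lower bound, so a positive
    [inf] is a genuine lower bound. *)
Lemma equilibrium_gt0 (M : R -> R) (v : R) :
  equilibrium g M -> - vmax g <= v <= vmax g -> 0 < M v.
Proof.
move=> hM vI; have inf0 := equilibrium_inf hM.
have [_ lbM] : has_inf (M @` `[- vmax g, vmax g]).
  by apply: contrapT => /inf_out inf_eq0; rewrite inf_eq0 ltxx in inf0.
apply: (lt_le_trans inf0); exact: ge_inf.
Qed.

Lemma extend_bounds (bc : boundary_condition) (f h : nat -> R) (m : R) (k : nat) :
  (forall i, (1 <= i <= Nx g)%N -> 0 <= f i + h i <= m) ->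
  (k <= (Nx g).+1)%N -> 0 <= extend g bc f k + extend g bc h k <= m.
Proof.
move=> fm kN; have N0 : (0 < Nx g)%N by rewrite muln_gt0 half_Nx_gt0.
rewrite /extend; case: eqP => [_|/eqP k0].
  by case: bc; apply: fm; rewrite N0 leqnn.
case: eqP => [_|/eqP kN1].
  by case: bc; apply: fm; rewrite N0 leqnn.
by apply: fm; rewrite lt0n k0 -ltnS ltn_neqAle kN1.
Qed.

(** Depending on the sign of the velocity only one of the two fluxes is
    active, and with the Courant number [c = dt |v| / dx < 1] the updated
    value is [(1 - c) u_i + c u_(i -/+ 1)]. *)
Lemma transport_bounds (bc : boundary_condition) (phi : nat -> R)
    (eta : nat -> nat -> R) (m : R) (i j : nat) :
  vmax g * dt g / dx g < 1 ->
  (forall k, (1 <= k <= Nx g)%N -> 0 <= phi k + eta k j <= m) ->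
  (1 <= i <= Nx g)%N -> (1 <= j <= Nv g)%N ->
  0 <= phi i + eta i j - dt g * upwind g bc phi eta i j <= m.
Proof.
move=> cfl um iI jI; have /andP[i1 iN] := iI.
have uE : extend g bc phi i + extend g bc (eta^~ j) i = phi i + eta i j.
  by rewrite /extend eqn0Ngt i1 /= ltn_eqF.
have /andP[a0 am] := um i iI.
have /andP[b0 bm] : 0 <= extend g bc phi i.-1 + extend g bc (eta^~ j) i.-1 <= m.
  by apply: extend_bounds => //; rewrite (leq_trans (leq_pred i)) ?leqW.
have /andP[c0 cm] : 0 <= extend g bc phi i.+1 + extend g bc (eta^~ j) i.+1 <= m.
  exact: extend_bounds.
rewrite /upwind uE.
set a := phi i + eta i j in a0 am *.
set b := extend g bc phi i.-1 + _ in b0 bm *.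
set c := extend g bc phi i.+1 + _ in c0 cm *.
set q := dt g / dx g.
have q0 : 0 <= q by rewrite divr_ge0 ?ltW ?dt_gt0 ?dx_gt0.
have -> : dt g * (vplus g j * ((a - b) / dx g) + vminus g j * ((c - a) / dx g))
    = (vplus g j * q) * (a - b) + (vminus g j * q) * (c - a).
  by rewrite /q; ring.
have {}cfl : vmax g * q < 1 by rewrite /q mulrA.
have /andP[vlo vhi] := vnode_bounds jI.
rewrite /vplus /vminus; case: (leP (vnode g j) 0) => v0.
- have : 0 <= - vnode g j * q by rewrite mulr_ge0 // oppr_ge0.
  have : - vnode g j * q <= vmax g * q by rewrite ler_wpM2r//; lra.
  by rewrite !mul0r => ? ?; apply/andP; split; nra.
- have : 0 <= vnode g j * q by rewrite mulr_ge0 // ltW.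
  have : vnode g j * q <= vmax g * q by rewrite ler_wpM2r.
  by rewrite !mul0r => ? ?; apply/andP; split; nra.
Qed.

End GridFacts.

(** * One time step *)

Lemma equal_sums_le (R : realType) (a b : nat) (F G : nat -> R) :
  (a < b)%N -> \sum_(a <= j < b) F j = \sum_(a <= j < b) G j ->
  exists2 j, (a <= j < b)%N & F j <= G j.
Proof.
move=> ab FG; apply: contrapT => noj.
have : \sum_(a <= j < b) G j < \sum_(a <= j < b) F j.
  apply: ltr_sum_nat => // j jab; rewrite ltNge; apply/negP => FGj.
  by apply: noj; exists j.
by rewrite FG ltxx.
Qed.

Section SchemeStep.
Variables (R : realType) (g : grid R) (bc : boundary_condition) (M : R -> R).
Variables (eps r m : R) (phi H : nat -> nat -> R) (eta : nat -> nat -> nat -> R).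
Hypotheses (hM : equilibrium g M) (heps : 0 < eps) (hr : 0 <= r).
Hypotheses (hm : 0 < m) (hS : scheme g bc eps r M phi H eta).

(** The phase equation says [(r dt - phi^n + dt H) / eps = - phi^(n+1) / eps],
    so the two exponentials in the birth term combine into
    [exp (- phi^(n+1) / eps)]. *)
Lemma scheme_step (n i j : nat) :
  (n < Nt g)%N -> (1 <= i <= Nx g)%N -> (1 <= j <= Nv g)%N ->
  implicit_part eps r (dt g) (phi n.+1 i) (eta n.+1 i j)
  = phi n i + eta n i j - dt g * upwind g bc (phi n) (eta n) i j.
Proof.
move=> nN iI jI; have dt0 := dt_gt0 g.
have dt_neq0 : dt g != 0 by rewrite gt_eqF.
have eps_neq0 : eps != 0 by rewrite gt_eqF.
have := scheme_eta hS nN iI jI.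
have HE : H n.+1 i = - r - (phi n.+1 i - phi n i) / dt g.
  by have := scheme_phi hS nN iI; lra.
rewrite HE -(mulrA r (expR _)) -expRD.
have -> : (r * dt g - phi n i) / eps
    + dt g * (- r - (phi n.+1 i - phi n i) / dt g) / eps = - phi n.+1 i / eps.
  by field; rewrite dt_neq0 eps_neq0.
rewrite /implicit_part (mulrBr (r * dt g * _)) mulr1 -(mulrA (r * dt g) (expR _)) -expRD.
have -> : eta n.+1 i j / eps + - (phi n.+1 i + eta n.+1 i j) / eps
    = - phi n.+1 i / eps by field.
move: (expR _) (expR _) (upwind _ _ _ _ _ _) => E P U eqn.
(* Clearing the time step from the denominators leaves a linear identity in
   the products of [dt], [r] and the exponentials. *)
have /= := congr1 (fun x => dt g * x) eqn.
rewrite !(mulrDr (dt g)) !(mulrN (dt g)).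
have divK x : dt g * (x / dt g) = x by rewrite mulrC divfK.
by rewrite !divK; lra.
Qed.

(** The means of [M] and of [M exp (- eta / eps)] agree, so the weight
    [exp (- eta / eps)] is neither everywhere above nor everywhere below 1. *)
Lemma eta_changes_sign (n i : nat) : (n < Nt g)%N -> (1 <= i <= Nx g)%N ->
  (exists2 j, (1 <= j <= Nv g)%N & 0 <= eta n.+1 i j) /\
  (exists2 j, (1 <= j <= Nv g)%N & eta n.+1 i j <= 0).
Proof.
move=> nN iI.
have Nv0 : (1 < (Nv g).+1)%N by rewrite ltnS muln_gt0 half_Nv_gt0.
have sumE : \sum_(1 <= j < (Nv g).+1)
      M (vnode g j) * expR (- eta n.+1 i j / eps)
    = \sum_(1 <= j < (Nv g).+1) M (vnode g j).
  apply: (mulfI (lt0r_neq0 (dv_gt0 g))).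
  exact: etrans (scheme_norm hS nN iI) (esym (equilibrium_norm hM)).
have M0 j : (1 <= j <= Nv g)%N -> 0 < M (vnode g j).
  by move=> jI; apply: (equilibrium_gt0 hM); apply: vnode_bounds.
split.
- have [j jI] := equal_sums_le Nv0 sumE.
  rewrite ltnS in jI; rewrite ger_pMr ?M0// expR_div_le1// oppr_le0.
  by exists j.
- have [j jI] := equal_sums_le Nv0 (esym sumE).
  rewrite ltnS in jI; rewrite ler_pMr ?M0// expR_div_ge1// oppr_ge0.
  by exists j.
Qed.

Hypothesis hCFL : vmax g * dt g / dx g < 1.

Lemma maximum_principle_step (n : nat) : (n < Nt g)%N ->
  (forall i j, (1 <= i <= Nx g)%N -> (1 <= j <= Nv g)%N ->
    0 <= phi n i + eta n i j <= m) ->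
  forall i j, (1 <= i <= Nx g)%N -> (1 <= j <= Nv g)%N ->
  [/\ 0 <= phi n.+1 i <= m, 0 <= eta n.+1 i j + phi n.+1 i <= m
    & 0 <= implicit_part eps r (dt g) (phi n.+1 i) (eta n.+1 i j) <= m].
Proof.
move=> nN um i j iI jI; have dt0 := dt_gt0 g.
have G k : (1 <= k <= Nv g)%N ->
    0 <= implicit_part eps r (dt g) (phi n.+1 i) (eta n.+1 i k) <= m.
  move=> kI; rewrite scheme_step//; apply: transport_bounds => // l lI.
  exact: um.
have [[k kI k0] [l lI l0]] := eta_changes_sign nN iI.
have /andP[_ Gk] := G k kI; have /andP[Gl _] := G l lI.
have phi_bounds : 0 <= phi n.+1 i <= m.
  apply/andP; split; first exact: implicit_part_ge_phi l0 Gl.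
  exact: implicit_part_le_phi k0 Gk.
split=> //; last exact: G.
exact: implicit_bounds phi_bounds (G j jI).
Qed.

End SchemeStep.

Unset Implicit Arguments.

Theorem proposition3 (R : realType) (g : grid R) (bc : boundary_condition)
    (M : R -> R) (eps r m : R)
    (phi H : nat -> nat -> R) (eta : nat -> nat -> nat -> R)
    (hM : equilibrium g M)
    (heps : 0 < eps) (hr : 0 <= r)
    (hCFL : vmax g * dt g / dx g < 1)
    (hm : 0 < m)
    (hS : scheme g bc eps r M phi H eta)
    (hphi0 : forall i, (1 <= i <= Nx g)%N -> 0 <= phi 0%N i <= m)
    (heta0 : forall i j, (1 <= i <= Nx g)%N -> (1 <= j <= Nv g)%N ->
       eta 0%N i j = 0) :
  forall n i j, (n < Nt g)%N -> (1 <= i <= Nx g)%N -> (1 <= j <= Nv g)%N ->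
    [/\ 0 <= phi n.+1 i <= m,
        0 <= eta n.+1 i j + phi n.+1 i <= m
      & 0 <= phi n.+1 i + eta n.+1 i j
             - dt g * (1 - expR (eta n.+1 i j / eps))
             + r * dt g * expR (eta n.+1 i j / eps)
               * (1 - expR (- (phi n.+1 i + eta n.+1 i j) / eps)) <= m].
Proof.
move=> n i j nN iI jI.
have step := maximum_principle_step hM heps hr hm hS hCFL.
apply: (step n nN _ i j iI jI) => {i j iI jI}.
elim: n nN => [_|n IH nN] i j iI jI; first by rewrite heta0// addr0 hphi0.
have nN' := ltnW nN.
by have [_ + _] := step n nN' (IH nN') i j iI jI; rewrite addrC.
Qed.
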